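(* Let $\{\mathcal S_j\}_{j=1}^{n_s}$ be a dictionary of shapes in $D$ with dictionary bearing matrix $B\in\{0,1\}^{n_\Omega\times n_s}$. Let $\alpha^*\in\mathbb R^{n_s}$ have support $\Gamma$, let $c\in\mathbb R^{n_s}$ satisfy $c_j=\mathrm{sign}(\alpha_j^* )$ for $j\in\Gamma$ and $\|c_{\Gamma^c}\|_\infty\le1$, and let $\tau=\|\alpha^*\|_1$, so that $\alpha^*$ is feasible for $$\min_\alpha\ G(\alpha)\quad\text{s.t.}\quad c^T\alpha=\tau.\qquad(\mathrm{P})$$ Suppose all entries of $\beta^*=B\alpha^*$ lie outside the open interval $(0,1)$. Let $\Gamma_{0^-},\Gamma_0,\Gamma_1,\Gamma_{1^+}$ be the sets of $i\in\{1,\dots,n_\Omega\}$ with $\beta_i^*<0$, $\beta_i^*=0$, $\beta_i^*=1$, $\beta_i^*>1$ respectively; let $l,u\in\mathbb R^{\Gamma_0\cup\Gamma_1}$ be given by $$l_\ell=\begin{cases} q_\ell-p_\ell & \ell\in\Gamma_0 \\ -p_\ell & \ell\in\Gamma_1 \end{cases},\qquad u_\ell=\begin{cases} q_\ell & \ell\in\Gamma_0 \\ q_\ell-p_\ell & \ell\in\Gamma_1 \end{cases},$$ and let $e\in\mathbb R^{n_s}$ be given by $e_j=\sum_{\ell\in\mathcal I_j\cap\Gamma_{1^+}}p_\ell-\sum_{\ell\in\mathcal I_j\cap\Gamma_{0^-}}q_\ell$. If the matrix $\big[(B_{\Gamma_0\cup\Gamma_1,:})^T,\ c\big]$ has full row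 rank and there exist $\eta\in\mathbb R^{\Gamma_0\cup\Gamma_1}$ and $\eta_c\in\mathbb R$ such that $$\big[(B_{\Gamma_0\cup\Gamma_1,:})^T,\ c\big]\begin{bmatrix} \eta \\ \eta_c \end{bmatrix}=e\qquad\text{and}\qquad l\prec\eta\prec u\ \text{(entrywise strict)},$$ then $\alpha^*$ is the unique minimizer of (P).
   Context: $D\subset\mathbb R^d$ is the imaging domain (an open set or the closure of an open set); closure, interior, boundary and complement ($\mathcal S^c=D\setminus\mathcal S$) are taken relative to $D$. $\Pi_{in},\Pi_{ex}:D\to[0,\infty)$ are fixed integrable functions. A shape is a closed set $\mathcal S\subset D$ with nonempty interior; boundary points and null sets are disregarded, in the sense that shapes satisfy $\mathcal S=\mathrm{cl}(\mathrm{int}\,\mathcal S)$ and have Lebesgue-null boundary. For $\alpha\in\mathbb R^{n_s}$, $\mathcal L_\alpha(x)=\sum_{j=1}^{n_s}\alpha_j\chi_{\mathcal S_j}(x)$ ($\chi$ = characteristic function) and $$G(\alpha)=\int_D\max\Big(\big(\Pi_{in}(x)-\Pi_{ex}(x)\big)\mathcal L_\alpha(x),\ \big(\Pi_{in}(x)-\Pi_{ex}(x)\big)^-\Big)dx,\qquad t^+=\max(t,0),\ t^-=\min(t,0).$$ Disjoint shape decomposition of $\mathcal S_1,\dots,\mathcal S_{n_s}$: for nonzero $J\in\{0,1\}^{n_s}$ put $\Omega_J=\bigcap_{j=1}^{n_s}\Theta_{J_j}(\mathcal S_j)$, where $\Theta_1(\mathcal S)=\mathcal S$, $\Theta_0(\mathcal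 S)=\mathrm{cl}(\mathcal S^c)$. The shapelets are the sets $\Omega_J$ with nonempty interior, indexed $\Omega_1,\dots,\Omega_{n_\Omega}$ with distinct constructor vectors $J^{(1)},\dots,J^{(n_\Omega)}$. The dictionary bearing matrix has entries $B_{i,j}=J^{(i)}_j$, and $\mathcal I_j=\{i:J^{(i)}_j=1\}$. Finally $$p_i=\int_{\Omega_i}\big(\Pi_{in}(x)-\Pi_{ex}(x)\big)^+dx,\qquad q_i=\int_{\Omega_i}\big(\Pi_{ex}(x)-\Pi_{in}(x)\big)^+dx.$$ $B_{A,:}$ denotes the restriction of $B$ to the rows indexed by $A$. *)

(* Defs.v *)
From HB Require Import structures.
From mathcomp Require Export all_boot all_order all_algebra.
From mathcomp Require Export all_classical all_reals all_analysis.
Export numFieldNormedType.Exports.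

Set Implicit Arguments.
Unset Strict Implicit.
Unset Printing Implicit Defensive.
Import Order.TTheory GRing.Theory Num.Theory.

Local Open Scope classical_set_scope.
Local Open Scope ring_scope.

(* Lebesgue measure on R^d, obtained as usual from the outer measure by covers
   with countably many boxes, restricted to its Caratheodory sigma-algebra. *)
Section lebesgue_rV.
Context {R : realType} {d : nat}.
Implicit Types (X : set 'rV[R]_d) (c : option ('rV[R]_d * 'rV[R]_d)).

(* [None] is the empty box, which for d = 0 is not of the form ]a, b]; without
   it the outer measure of the empty set would be infinite there. *)
Definition box c : set 'rV[R]_d :=
  if c is Some (a, b) then [set x | forall i, a 0 i < x 0 i <= b 0 i]
  else set0.

Definition box_volume c : \bar R :=
  if c is Some (a, b) then (\prod_(i < d) Num.max (b 0 i - a 0 i) 0)%:E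
  else 0%:E.

Definition lebesgue_outer X : \bar R :=
  ereal_inf [set (\sum_(k <oo) box_volume (C k))%E |
    C in [set C : nat -> option ('rV[R]_d * 'rV[R]_d) |
           X `<=` \bigcup_k box (C k)]].

Lemma box_volume_ge0 c : (0 <= box_volume c)%E.
Proof.
case: c => [[a b]|] //=; rewrite lee_fin.
by apply: prodr_ge0 => i _; rewrite le_max lexx orbT.
Qed.

Lemma lebesgue_outer_ge0 X : (0 <= lebesgue_outer X)%E.
Proof.
apply: le_ereal_inf_tmp => _ [C _ <-].
by apply: nneseries_ge0 => k _ _; exact: box_volume_ge0.
Qed.

Lemma lebesgue_outer0 : lebesgue_outer set0 = 0%E.
Proof.
apply/eqP; rewrite eq_le lebesgue_outer_ge0 andbT.
apply: ereal_inf_lbound; exists (fun=> None); first exact: sub0set.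
by rewrite eseries0.
Qed.

Lemma le_lebesgue_outer : {homo lebesgue_outer : A B / A `<=` B >-> (A <= B)%E}.
Proof.
move=> A B AB; apply: ereal_inf_le_tmp => x [C BC <-].
by exists C => //; exact: subset_trans AB BC.
Qed.

Lemma lebesgue_outer_sigma_subadditive : sigma_subadditive lebesgue_outer.
Proof.
move=> A; have [[i ioo]|] := pselect (exists i, lebesgue_outer (A i) = +oo%E).
  rewrite (eseries_pinfty _ _ ioo) ?leey// => n _.
  by rewrite -ltNye (lt_le_trans _ (lebesgue_outer_ge0 _)).
rewrite -forallNE => Aoo.
suff add2e (e : {posnum R}) : (lebesgue_outer (\bigcup_n A n) <=
    \sum_(i <oo) lebesgue_outer (A i) + e%:num%:E)%E.
  by apply/lee_addgt0Pr => _/posnumP[].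
rewrite (le_trans _ (epsilon_trick _ _ _))//; last first.
  by move=> n; exact: lebesgue_outer_ge0.
pose P n (B : nat -> option ('rV[R]_d * 'rV[R]_d)) :=
  A n `<=` \bigcup_k box (B k) /\
  (\sum_(k <oo) box_volume (B k) <=
    lebesgue_outer (A n) + (e%:num / (2 ^ n.+1)%:R)%:E)%E.
have [G PG] : {G & forall n, P n (G n)}.
  apply: (@choice _ _ P) => n; rewrite /P.
  have fA : lebesgue_outer (A n) \is a fin_num.
    by rewrite ge0_fin_numE ?lebesgue_outer_ge0// ltey; exact/eqP.
  have en1 : 0 < e%:num / (2 ^ n.+1)%:R by [].
  have [_ [B AB <-] xS] := lb_ereal_inf_adherent en1 fA.
  by exists B; split => //; exact/ltW.
have vG_ge0 x : (0 <= (box_volume \o uncurry G) x)%E by exact: box_volume_ge0.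
apply: (@le_trans _ _ (\esum_(i in setT) (box_volume \o uncurry G) i)%E).
  apply: ereal_inf_lbound => /=.
  have /card_esym/ppcard_eqP[f] := card_nat2.
  exists (uncurry G \o f).
    move=> t [i _] /(PG i).1[j _ Bijt]; exists (f^-1%FUN (i, j)) => //=.
    by rewrite invK ?inE.
  rewrite -(esum_pred_image (box_volume \o uncurry G) _ xpredT) ?[fun=> _]set_true//.
  by rewrite image_eq.
rewrite (_ : esum _ _ = \sum_(i <oo) \sum_(j <oo) box_volume (G i j))%E; last first.
  pose J : nat -> set (nat * nat) := fun i => [set (i, j) | j in setT].
  rewrite (_ : setT = \bigcup_k J k); last first.
    by rewrite predeqE => -[a b]; split => // _; exists a => //; exists b.
  rewrite esum_bigcupT /=; last 2 first.
    - apply/trivIsetP => i j _ _ ij.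
      rewrite predeqE => -[n m] /=; split => //= -[] [_] _ [<-{n} _].
      by move=> [m' _] [] /esym/eqP; rewrite (negbTE ij).
    - by move=> /= [n m]; exact: box_volume_ge0.
  rewrite -(image_id [set: nat]) -fun_true esum_pred_image//; last first.
    by move=> n _; apply: esum_ge0 => m _; exact: vG_ge0.
  apply: eq_eseriesr => /= j _.
  rewrite -(esum_pred_image (box_volume \o uncurry G) (pair j) predT)/=; last 2 first.
    - by move=> n _; exact: (vG_ge0 (j, n)).
    - by move=> ? ? _ _; exact: (@can_inj _ _ _ snd).
  by congr esum; rewrite predeqE => -[a b]; split; move=> [i _ <-]; exists i.
apply: lee_nneseries => n *; last exact: (PG n).2.
by apply: nneseries_ge0 => m *; exact: (vG_ge0 (n, m)).
Qed.

HB.instance Definition _ := isOuterMeasure.Build R 'rV[R]_d lebesgue_outer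
  lebesgue_outer0 lebesgue_outer_ge0 le_lebesgue_outer
  lebesgue_outer_sigma_subadditive.

Definition lebesgue_rV : set (caratheodory_type lebesgue_outer) -> \bar R :=
  lebesgue_outer.

HB.instance Definition _ := isMeasure.Build _ _ _ lebesgue_rV
  (@caratheodory_measure0 _ _ lebesgue_outer)
  (@caratheodory_measure_ge0 _ _ lebesgue_outer)
  (@caratheodory_measure_sigma_additive _ _ lebesgue_outer).

End lebesgue_rV.

Section shapes.
Context {R : realType} {d : nat}.
Implicit Types (D S : set 'rV[R]_d) (Pin Pex : 'rV[R]_d -> R).

Definition imaging_domain D : Prop :=
  open D \/ exists U : set 'rV[R]_d, open U /\ D = closure U.

(* For S `<=` D, closure and interior in [subspace D] are the relative ones:
   points outside D are isolated in that topology. *)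
Definition rel_closure D S : set 'rV[R]_d := closure (S : set (subspace D)).
Definition rel_interior D S : set 'rV[R]_d := interior (S : set (subspace D)).
Definition rel_boundary D S : set 'rV[R]_d :=
  rel_closure D S `\` rel_interior D S.

Definition shape_in D S : Prop :=
  [/\ S `<=` D, closed (S : set (subspace D)), rel_interior D S !=set0,
      S = rel_closure D (rel_interior D S)
    & lebesgue_rV (rel_boundary D S) = 0%E].

Definition nonneg_integrable D (f : 'rV[R]_d -> R) : Prop :=
  (forall x, D x -> 0 <= f x) /\
  (@lebesgue_rV R d).-integrable D (EFin \o f).

Definition level {ns : nat} (S : 'I_ns -> set 'rV[R]_d) (alpha : 'cV[R]_ns)
    (x : 'rV[R]_d) : R :=
  \sum_(j < ns) alpha j 0 * \1_(S j) x.

Definition shape_cost {ns : nat} D Pin Pex (S : 'I_ns -> set 'rV[R]_d)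
    (alpha : 'cV[R]_ns) : R :=
  \int[lebesgue_rV]_(x in D)
    Num.max ((Pin x - Pex x) * level S alpha x) (Num.min (Pin x - Pex x) 0).

Definition theta D (b : bool) S : set 'rV[R]_d :=
  if b then S else rel_closure D (D `\` S).

Definition omega {ns : nat} D (S : 'I_ns -> set 'rV[R]_d)
    (J : {ffun 'I_ns -> bool}) : set 'rV[R]_d :=
  \bigcap_(j in [set: 'I_ns]) theta D (J j) (S j).

(* J lists, without repetition, the constructor vectors of all shapelets. *)
Definition shapelet_indexing {ns nO : nat} D (S : 'I_ns -> set 'rV[R]_d)
    (J : 'I_nO -> {ffun 'I_ns -> bool}) : Prop :=
  injective J /\
  forall K : {ffun 'I_ns -> bool},
    (exists i, J i = K) <->
    (K != [ffun=> false] /\ rel_interior D (omega D S K) !=set0).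

Definition bearing_matrix {ns nO : nat} (J : 'I_nO -> {ffun 'I_ns -> bool}) :
    'M[R]_(nO, ns) :=
  \matrix_(i, j) (J i j)%:R.

Definition p_mass Pin Pex (O : set 'rV[R]_d) : R :=
  \int[lebesgue_rV]_(x in O) Num.max (Pin x - Pex x) 0.

Definition q_mass Pin Pex (O : set 'rV[R]_d) : R :=
  \int[lebesgue_rV]_(x in O) Num.max (Pex x - Pin x) 0.

End shapes.

Definition feasible {R : realType} {n : nat} (c : 'cV[R]_n) (tau : R)
    (alpha : 'cV[R]_n) : Prop :=
  (c^T *m alpha) 0 0 = tau.

Definition minimizer {R : realType} {n : nat} (f : 'cV[R]_n -> R)
    (F : 'cV[R]_n -> Prop) (alpha : 'cV[R]_n) : Prop :=
  F alpha /\ forall alpha', F alpha' -> f alpha <= f alpha'.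

(* B_{A,:}: its k-th row is the row of B indexed by the k-th element of A;
   column vectors in R^A are indexed in the same way. *)
Definition row_restrict {R : realType} {m n : nat} (A : {set 'I_m})
    (B : 'M[R]_(m, n)) : 'M[R]_(#|A|, n) :=
  rowsub (fun k : 'I_#|A| => enum_val k) B.

(* Main.v *)
Require Import Defs.
From mathcomp Require Import ring lra measurable_realfun.
Set Implicit Arguments.
Unset Strict Implicit.
Unset Printing Implicit Defensive.
Import Order.TTheory GRing.Theory Num.Theory.
Local Open Scope classical_set_scope.
Local Open Scope ring_scope.

(** The shape cost depends on alpha only through beta = B alpha, and it is a
separable convex piecewise linear function of beta:
  G(alpha) = sum_i (p_i max(beta_i, 0) - q_i min(beta_i, 1))
([shape_costE]). Indeed, outside the boundaries of the shapes, which form a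
null set, a point x belongs to exactly one of the sets omega D S K, the one
whose constructor vector K records the shapes that contain x. There the level
function has the constant value beta_i, and the integrand splits according to
the sign of w = Pin - Pex ([integrand_split]). If K is nonzero, then x is an
interior point of omega D S K, so that K is the constructor vector of a
shapelet; if K is zero, the integrand vanishes at x.

Each summand has slope - q_i on beta_i < 0, p_i - q_i on 0 < beta_i < 1 and
p_i on 1 < beta_i, hence kinks at 0 and at 1. The inequalities l < eta < u say
that - eta_i lies strictly between the one-sided slopes of the kink at
beta*_i. Taking the slope p_i or - q_i for the other indices gives a
subgradient sigma at beta*, and the linear system for (eta, eta_c) says
exactly that B^T sigma = eta_c c. So moving from alpha* within the hyperplane
c^T alpha = tau does not change the linear minorant of the cost: alpha* is a
minimizer ([first_order_minimizer]). At another minimizer no summand may grow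
strictly faster than its minorant, so beta_i is unchanged for every kink i;
together with c^T alpha = tau and the full row rank of [B_A^T, c] this leaves
only alpha* ([first_order_unique]).

Splitting integrals along the shapelets requires that relatively closed
subsets of D are Lebesgue measurable. This is proved for open sets first
([open_lebesgue_measurable]): halfspaces satisfy the Caratheodory criterion
because they cut every box into two boxes whose volumes add up, and open sets
are countable unions of boxes with rational corners. *)

(** * Lebesgue measurability of open sets *)

Section lebesgue_measurable_sets.
Context {R : realType} {d : nat}.
Implicit Types (X : set 'rV[R]_d) (c : option ('rV[R]_d * 'rV[R]_d)).
Implicit Types (i : 'I_d) (t : R).

Definition halfspace i t : set 'rV[R]_d := [set x | x 0 i <= t].

Definition cut_below i t c :=
  if c is Some (a, b)
  then Some (a, \row_k if k == i then Num.min (b 0 k) t else b 0 k)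
  else None.

Definition cut_above i t c :=
  if c is Some (a, b)
  then Some (\row_k (if k == i then Num.max (a 0 k) t else a 0 k), b)
  else None.

Lemma box_cut_below i t c : box c `&` halfspace i t `<=` box (cut_below i t c).
Proof.
case: c => [[a b]|] x [] //= xab xt k; rewrite mxE.
have /andP[ax xb] := xab k; rewrite ax.
by case: eqP => [->|//]; rewrite le_min; have /andP[_ ->] := xab i.
Qed.

Lemma box_cut_above i t c :
  box c `&` ~` halfspace i t `<=` box (cut_above i t c).
Proof.
case: c => [[a b]|] x [] //= xab /negP; rewrite -ltNge => xt k; rewrite mxE.
have /andP[ax xb] := xab k; rewrite xb andbT.
by case: eqP => [->|//]; rewrite gt_max xt andbT; have /andP[] := xab i.
Qed.

(** Only the edges in direction i differ, and their lengths add up. If t lies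
outside the edge of the box, then one piece is empty: its edge would have
negative length, which the volume truncates to 0. *)
Lemma box_volume_cut i t c :
  box_volume c = (box_volume (cut_below i t c) + box_volume (cut_above i t c))%E.
Proof.
case: c => [[a b]|] /=; last by rewrite adde0.
rewrite -EFinD; congr EFin.
rewrite (bigD1 i)//= [in RHS](bigD1 i)//= [X in _ = _ + X](bigD1 i)//=.
rewrite !mxE eqxx.
have -> : \prod_(k < d | k != i) Num.max
    ((\row_k0 if k0 == i then Num.min (b 0 k0) t else b 0 k0) 0 k - a 0 k) 0
    = \prod_(k < d | k != i) Num.max (b 0 k - a 0 k) 0.
  by apply: eq_bigr => k /negPf ki; rewrite mxE ki.
have -> : \prod_(k < d | k != i) Num.max
    (b 0 k - (\row_k0 if k0 == i then Num.max (a 0 k0) t else a 0 k0) 0 k) 0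
    = \prod_(k < d | k != i) Num.max (b 0 k - a 0 k) 0.
  by apply: eq_bigr => k /negPf ki; rewrite mxE ki.
rewrite -mulrDl; congr (_ * _).
have [] := leP (a 0 i) t; have [] := leP (b 0 i) t;
  have [] := leP (b 0 i - a 0 i) 0; have [] := leP (t - a 0 i) 0;
  have [] := leP (b 0 i - t) 0; lra.
Qed.

(** Cutting each box of a cover of X along the hyperplane gives covers of the
two parts of X whose total volumes add up to that of the original cover. *)
Lemma halfspace_measurable i t :
  (@lebesgue_outer R d).-cara.-measurable (halfspace i t).
Proof.
apply: le_caratheodory_measurable => X.
apply: le_ereal_inf_tmp => _ [C XC <-].
have -> : (\sum_(k <oo) box_volume (C k) =
    \sum_(k <oo) box_volume (cut_below i t (C k)) +
    \sum_(k <oo) box_volume (cut_above i t (C k)))%E.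
  rewrite -nneseriesD; [|by move=> *; exact: box_volume_ge0..].
  by apply: eq_eseriesr => k _; exact: box_volume_cut.
apply: leeD; apply: ereal_inf_lbound.
- exists (fun k => cut_below i t (C k)) => // x [/XC[k _ Ckx] xt].
  by exists k => //; exact: box_cut_below.
- exists (fun k => cut_above i t (C k)) => // x [/XC[k _ Ckx] xt].
  by exists k => //; exact: box_cut_above.
Qed.

Lemma box_measurable c : (@lebesgue_outer R d).-cara.-measurable (box c).
Proof.
case: c => [[a b]|]; last exact: measurable0.
have -> : box (Some (a, b)) =
    \bigcap_i (~` halfspace i (a 0 i) `&` halfspace i (b 0 i)).
  apply/seteqP; split => x /= xab i => [_|].
    have /andP[ax xb] := xab i; split => //.
    by apply/negP; rewrite -ltNge.
  have [/negP] := xab i I; rewrite -ltNge => ax xb.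
  by rewrite ax.
apply: fin_bigcap_measurable => // i _; apply: measurableI.
  by apply: measurableC; exact: halfspace_measurable.
exact: halfspace_measurable.
Qed.

(** There are only countably many boxes with rational corners, and those inside
an open set already cover it. *)
Lemma open_lebesgue_measurable (U : set 'rV[R]_d) :
  open U -> (@lebesgue_outer R d).-cara.-measurable U.
Proof.
move=> oU.
pose rbox (ab : 'rV[rat]_d * 'rV[rat]_d) : set 'rV[R]_d :=
  box (Some (map_mx ratr ab.1, map_mx ratr ab.2)).
pose F ab : set 'rV[R]_d := if pselect (rbox ab `<=` U) then rbox ab else set0.
have -> : U = \bigcup_ab F ab.
  apply/seteqP; split => x; last first.
    by move=> [ab _]; rewrite /F; case: pselect => // + /=; apply.
  move=> /oU /nbhs_ballP[e /= e0 xeU].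
  have [f xf] : {f : 'I_d -> rat & forall i, x 0 i - e < ratr (f i) < x 0 i}.
    apply: (@choice _ _ (fun i q => x 0 i - e < ratr q < x 0 i)) => i.
    have /rat_in_itvoo[q] : x 0 i - e < x 0 i by lra.
    by rewrite in_itv => ?; exists q.
  have [g xg] : {g : 'I_d -> rat & forall i, x 0 i < ratr (g i) < x 0 i + e}.
    apply: (@choice _ _ (fun i q => x 0 i < ratr q < x 0 i + e)) => i.
    have /rat_in_itvoo[q] : x 0 i < x 0 i + e by lra.
    by rewrite in_itv => ?; exists q.
  exists (\row_i f i, \row_i g i) => //; rewrite /F; case: pselect => [?|[]].
    move=> i /=; rewrite !mxE.
    by have /andP[_ ->] := xf i; have /andP[/ltW ->] := xg i.
  move=> y yfg; apply: xeU; split => // j i; rewrite ord1.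
  have := yfg i; rewrite /= !mxE.
  have := xf i; have := xg i; rewrite /ball /= ltr_norml; lra.
apply: countable_bigcupT_measurable => // ab; rewrite /F.
case: pselect => ?; last exact: measurable0.
exact: (@box_measurable (Some (map_mx ratr ab.1, map_mx ratr ab.2))).
Qed.

End lebesgue_measurable_sets.

(** * Shapes and shapelets off the relative boundaries *)

Section shapelets.
Context {R : realType} {d : nat}.
Implicit Types (D C S : set 'rV[R]_d).

Local Notation lebesgue_measurable := ((@lebesgue_outer R d).-cara.-measurable).

Lemma closed_lebesgue_measurable C : closed C -> lebesgue_measurable C.
Proof.
move=> cC; rewrite -[C]setCK; apply: measurableC.
by apply: open_lebesgue_measurable; exact: closed_openC.
Qed.

Lemma imaging_domain_measurable D : imaging_domain D -> lebesgue_measurable D.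
Proof.
case=> [/open_lebesgue_measurable//|[U [_ ->]]].
by apply: closed_lebesgue_measurable; exact: closed_closure.
Qed.

Lemma rel_closed_measurable D C : imaging_domain D -> C `<=` D ->
  closed (C : set (subspace D)) -> lebesgue_measurable C.
Proof.
move=> hD CD /closed_subspaceP[V cV VC].
rewrite -(setIidl CD) -VC; apply: measurableI.
  exact: closed_lebesgue_measurable.
exact: imaging_domain_measurable.
Qed.

Lemma rel_closure_sub D C : C `<=` D -> rel_closure D C `<=` D.
Proof. by move=> CD; rewrite /rel_closure closure_subspaceW//; exact: subIsetr. Qed.

Lemma theta_sub D (b : bool) S : S `<=` D -> theta D b S `<=` D.
Proof. by case: b => //= _; apply: rel_closure_sub => x []. Qed.

Lemma theta_measurable D (b : bool) S : imaging_domain D -> shape_in D S ->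
  lebesgue_measurable (theta D b S).
Proof.
move=> hD [SD cS _ _ _]; apply: (rel_closed_measurable hD (@theta_sub _ b _ SD)).
by case: b => //=; exact: closed_closure.
Qed.

Lemma rel_boundary_measurable D S : imaging_domain D -> shape_in D S ->
  lebesgue_measurable (rel_boundary D S).
Proof.
move=> hD [SD cS _ _ _].
have /open_closedC oSc : open (rel_interior D S : set (subspace D)).
  exact: open_interior.
apply: (rel_closed_measurable hD).
  by apply: subset_trans (rel_closure_sub SD); exact: subDsetl.
by rewrite /rel_boundary setDE; apply: closedI => //; exact: closed_closure.
Qed.

(** The closure in theta_0 only adds points of the boundary of S: a point of S
in the closure of its complement is not interior to S. *)
Lemma theta_off_boundary D S (b : bool) x : shape_in D S -> D x ->
  ~ rel_boundary D S x -> theta D b S x <-> b = `[< S x >].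
Proof.
move=> [SD _ _ _ _] Dx nbx.
have intS : S x -> rel_interior D S x.
  move=> Sx; apply: contrapT => nSx; apply: nbx; split => //.
  exact: (@subset_closure (subspace D)).
case: b => /=; first by split => [Sx|/esym/asboolP//]; apply/esym/asboolP.
split => [clx|/esym/asboolP nSx].
  apply/esym/asboolP => /intS /clx[y [[_ nSy]]].
  by [].
by apply: (@subset_closure (subspace D)).
Qed.

Context {ns : nat}.
Variable S : 'I_ns -> set 'rV[R]_d.

(** The constructor vector of the atom of the dictionary that contains x. *)
Definition membership x : {ffun 'I_ns -> bool} := [ffun j => `[< S j x >]].

Lemma omega_off_boundary D (K : {ffun 'I_ns -> bool}) x :
  (forall j, shape_in D (S j)) -> D x -> (forall j, ~ rel_boundary D (S j) x) ->
  omega D S K x <-> K = membership x.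
Proof.
move=> hS Dx nbx; split => [OKx|-> j _].
  apply/ffunP => j; rewrite ffunE.
  by apply/(theta_off_boundary _ (hS j) Dx (nbx j)); exact: OKx.
by apply/(theta_off_boundary _ (hS j) Dx (nbx j)); rewrite ffunE.
Qed.

(** A point of D off all boundaries is interior to each shape that contains it
and to the complement of each other shape. Hence an atom with nonzero
constructor vector is a shapelet as soon as it has such a point. *)
Lemma omega_interior D x :
  (forall j, shape_in D (S j)) -> D x -> (forall j, ~ rel_boundary D (S j) x) ->
  rel_interior D (omega D S (membership x)) x.
Proof.
move=> hS Dx nbx.
have : \forall y \near (x : subspace D), forall j,
    theta D (membership x j) (S j) y.
  apply: filter_forall => j; rewrite ffunE.
  have [SD cS _ _ _] := hS j.
  case: asboolP => Sjx /=.
    apply: contrapT => nSx; apply: (nbx j); split => //.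
    exact: (@subset_closure (subspace D)).
  have oDS : open (D `\` S j : set (subspace D)).
    by rewrite setDE; apply: openI; [exact: open_subspaceT|exact: closed_openC].
  have /(oDS x) : (D `\` S j) x by [].
  apply: filterS; exact: (@subset_closure (subspace D)).
by apply: filterS => y yth j _; exact: yth.
Qed.

Lemma ae_off_boundary D : imaging_domain D -> (forall j, shape_in D (S j)) ->
  {ae lebesgue_rV, forall x j, ~ rel_boundary D (S j) x}.
Proof.
move=> hD hS.
have := @filter_forall _ _ (fun j (x : caratheodory_type lebesgue_outer) =>
  ~ rel_boundary D (S j) x) (almost_everywhere (@lebesgue_rV R d)) _.
apply => j; exists (rel_boundary D (S j)); split.
- exact: rel_boundary_measurable.
- by have [] := hS j.
- by move=> x /= /contrapT.
Qed.

End shapelets.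

(** * The cost of a shapelet as a function of the level on it *)

Section shapelet_cost.
Context {R : realDomainType}.
Implicit Types p q s b x w : R.

Definition shapelet_cost p q b : R := p * Num.max b 0 - q * Num.min b 1.

(** The integrand of the shape cost at a point where Pin - Pex = w and the
level is b: for w >= 0 it is w max(b, 0), and for w < 0 it is w min(b, 1). *)
Lemma integrand_split w b :
  Num.max (w * b) (Num.min w 0) =
  shapelet_cost (Num.max w 0) (Num.max (- w) 0) b.
Proof.
rewrite /shapelet_cost.
have [w0|w0] := leP 0 w.
  by rewrite (max_r (x := - w)) ?oppr_le0// mul0r subr0 maxr_pMr// mulr0.
rewrite (max_l (x := - w)) ?oppr_ge0 1?ltW// mul0r sub0r mulNr opprK.
by rewrite minr_nMr ?mulr1// ltW.
Qed.

(** The four lemmas below give affine minorants that touch the cost at b. Away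
from the kinks 0 and 1 the slope is forced; at a kink any slope strictly
between the one-sided ones gives a minorant that touches nowhere else. *)
Lemma shapelet_cost_lt0 p q b x : 0 <= p -> 0 <= q -> b < 0 ->
  shapelet_cost p q b + - q * (x - b) <= shapelet_cost p q x.
Proof.
move=> p0 q0 b0; rewrite /shapelet_cost.
rewrite (max_r (ltW b0)) (min_l (x := b)); last by rewrite (le_trans (ltW b0)).
have : 0 <= p * Num.max x 0 by rewrite mulr_ge0// le_max lexx orbT.
have : q * Num.min x 1 <= q * x by rewrite ler_wpM2l// ge_min lexx.
by lra.
Qed.

Lemma shapelet_cost_gt1 p q b x : 0 <= p -> 0 <= q -> 1 < b ->
  shapelet_cost p q b + p * (x - b) <= shapelet_cost p q x.
Proof.
move=> p0 q0 b1; rewrite /shapelet_cost.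
rewrite (min_r (ltW b1)) (max_l (x := b)); last exact: le_trans (ltW b1).
have : p * x <= p * Num.max x 0 by rewrite ler_wpM2l// le_max lexx.
have : q * Num.min x 1 <= q * 1 by rewrite ler_wpM2l// ge_min lexx orbT.
by lra.
Qed.

Lemma shapelet_cost_at0 p q s x : 0 <= p -> 0 <= q -> - q < s < p - q ->
  x != 0 -> shapelet_cost p q 0 + s * (x - 0) < shapelet_cost p q x.
Proof.
move=> p0 q0 /andP[qs sp]; rewrite /shapelet_cost maxxx (min_l ler01) subr0.
rewrite !mulr0 subr0 add0r neq_lt => /orP[x0|x0].
  rewrite (max_r (ltW x0)) (min_l (x := x)); last by rewrite (le_trans (ltW x0)).
  by rewrite mulr0 sub0r -mulNr ltr_nM2r.
rewrite (max_l (ltW x0)).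
have : q * Num.min x 1 <= q * x by rewrite ler_wpM2l// ge_min lexx.
have : s * x < (p - q) * x by rewrite ltr_pM2r.
by lra.
Qed.

Lemma shapelet_cost_at1 p q s x : 0 <= p -> 0 <= q -> p - q < s < p ->
  x != 1 -> shapelet_cost p q 1 + s * (x - 1) < shapelet_cost p q x.
Proof.
move=> p0 q0 /andP[qs sp]; rewrite /shapelet_cost minxx (max_l ler01).
rewrite neq_lt => /orP[x1|x1].
  rewrite (min_l (ltW x1)).
  have : p * x <= p * Num.max x 0 by rewrite ler_wpM2l// le_max lexx.
  have : s * (x - 1) < (p - q) * (x - 1) by rewrite ltr_nM2r// subr_lt0.
  by lra.
rewrite (min_r (ltW x1)) (max_l (x := x)); last by rewrite (le_trans _ (ltW x1)).
have : s * (x - 1) < p * (x - 1) by rewrite ltr_pM2r// subr_gt0.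
by lra.
Qed.

End shapelet_cost.

(** * The shape cost in terms of the shapelets *)

Lemma Rintegral_sum d (T : measurableType d) (R : realType)
    (mu : {measure set T -> \bar R}) (D : set T) (I : Type) (s : seq I)
    (f : I -> T -> R) :
  measurable D -> (forall i, mu.-integrable D (EFin \o f i)) ->
  \int[mu]_(x in D) (\sum_(i <- s) f i x) =
  \sum_(i <- s) \int[mu]_(x in D) f i x.
Proof.
move=> mD intf.
have sumE : (fun x => (\sum_(i <- s) f i x)%:E) =
            (fun x => \sum_(i <- s) (EFin \o f i) x)%E.
  by apply/funext => x; rewrite sumEFin.
rewrite /Rintegral sumE integral_sum//.
by rewrite -sum_fine// => i _; exact: integrable_fin_num.
Qed.

Section cost.
Context {R : realType} {d ns nO : nat}.
Variables (D : set 'rV[R]_d) (S : 'I_ns -> set 'rV[R]_d).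
Variable J : 'I_nO -> {ffun 'I_ns -> bool}.

Hypothesis hD : imaging_domain D.
Hypothesis hS : forall j, shape_in D (S j).
Hypothesis hJ : shapelet_indexing D S J.

Local Notation mu := (@lebesgue_rV R d).
Local Notation lebesgue_measurable := ((@lebesgue_outer R d).-cara.-measurable).

Lemma shapelet_nonzero i : exists j, J i j.
Proof.
have [+ _] := (hJ.2 (J i)).1 (ex_intro _ i erefl).
apply: contra_neqP => /forallNP Ji; apply/ffunP => j; rewrite ffunE.
exact/negP.
Qed.

(** A shapelet is an intersection of at least one subset of D, because its
constructor vector is nonzero; an empty intersection is the whole space. *)
Lemma shapelet_sub i : omega D S (J i) `<=` D.
Proof.
move=> x; have [j _] := shapelet_nonzero i; move=> /(_ j I).
by apply: theta_sub; have [] := hS j.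
Qed.

Lemma shapelet_measurable i : lebesgue_measurable (omega D S (J i)).
Proof.
by apply: fin_bigcap_measurable => // j _; exact: theta_measurable.
Qed.

Lemma levelE (alpha : 'cV[R]_ns) x :
  level S alpha x = \sum_j (membership S x j)%:R * alpha j 0.
Proof.
apply: eq_bigr => j _; rewrite mulrC ffunE indicE.
by congr (_%:R * _); congr nat_of_bool; apply/idP/asboolP; rewrite inE.
Qed.

Lemma bearing_level (alpha : 'cV[R]_ns) i x : J i = membership S x ->
  (bearing_matrix J *m alpha) i 0 = level S alpha x.
Proof.
move=> Jx; rewrite levelE mxE; apply: eq_bigr => j _.
by rewrite mxE Jx.
Qed.

(** Cutting off the two parts of w outside the shapelet, instead of restricting
the domain of integration, lets all summands be integrated over D. *)
Definition shapelet_integrand (w : 'rV[R]_d -> R) (alpha : 'cV[R]_ns) i x :=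
  shapelet_cost (((fun y => Num.max (w y) 0) \_ (omega D S (J i))) x)
                (((fun y => Num.max (- w y) 0) \_ (omega D S (J i))) x)
                ((bearing_matrix J *m alpha) i 0).

(** Off the boundaries at most one summand is nonzero, the one of the shapelet
that contains x; all of them vanish when x is in no shape, and then the level
is zero too. *)
Lemma integrand_shapelets (alpha : 'cV[R]_ns) (w : 'rV[R]_d -> R) x : D x ->
  (forall j, ~ rel_boundary D (S j) x) ->
  Num.max (w x * level S alpha x) (Num.min (w x) 0) =
  \sum_(i < nO) shapelet_integrand w alpha i x.
Proof.
move=> Dx nbx.
have memE i : (x \in omega D S (J i)) = (J i == membership S x).
  apply/idP/eqP => [/set_mem|Ji]; last apply/mem_set.
    by move/(omega_off_boundary _ hS Dx nbx).
  exact/(omega_off_boundary _ hS Dx nbx).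
have outside i : J i != membership S x -> shapelet_integrand w alpha i x = 0.
  move=> Ji; rewrite /shapelet_integrand /shapelet_cost.
  by rewrite !patchE memE (negPf Ji) !mul0r subrr.
have [x0|x0] := eqVneq (membership S x) [ffun=> false].
  rewrite levelE big1 ?mulr0; last by move=> j _; rewrite x0 ffunE mul0r.
  rewrite max_l ?ge_min ?lexx ?orbT// big1// => i _; apply: outside.
  by have [] := (hJ.2 (J i)).1 (ex_intro _ i erefl); rewrite x0.
have [i Ji] : exists i, J i = membership S x.
  by apply/hJ.2; split => //; exists x; exact: omega_interior.
rewrite (bigD1 i)//= big1 ?addr0; last first.
  move=> k ki; apply: outside; apply: contra_neq ki => Jk.
  by apply: hJ.1; rewrite Jk Ji.
by rewrite /shapelet_integrand !patchE memE Ji eqxx integrand_split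
  (bearing_level _ Ji).
Qed.

Variables Pin Pex : 'rV[R]_d -> R.
Hypothesis hPin : nonneg_integrable D Pin.
Hypothesis hPex : nonneg_integrable D Pex.

(** The integrals of the summands are masses of shapelets because shapelets
are contained in D. *)
Lemma shape_costE (alpha : 'cV[R]_ns) :
  shape_cost D Pin Pex S alpha =
  \sum_(i < nO)
    shapelet_cost (p_mass Pin Pex (omega D S (J i)))
                  (q_mass Pin Pex (omega D S (J i)))
                  ((bearing_matrix J *m alpha) i 0).
Proof.
pose w x := Pin x - Pex x.
have mD := imaging_domain_measurable hD.
have intw : mu.-integrable D (EFin \o w).
  by have := integrableB mD hPin.2 hPex.2.
have intNw : mu.-integrable D (EFin \o (fun x => - w x)).
  by have := integrableN intw.
have mw : measurable_fun (D : set (caratheodory_type (@lebesgue_outer R d))) w.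
  by apply/measurable_EFinP; exact: measurable_int intw.
have intp i :
    mu.-integrable D (EFin \o ((fun x => Num.max (w x) 0) \_ (omega D S (J i)))).
  rewrite -restrict_EFin; apply/integrable_restrict => //.
    exact: shapelet_measurable.
  apply: integrableS (integrable_funrpos mD intw) => //.
  by apply: measurableI => //; exact: shapelet_measurable.
have intq i :
    mu.-integrable D (EFin \o ((fun x => Num.max (- w x) 0) \_ (omega D S (J i)))).
  rewrite -restrict_EFin; apply/integrable_restrict => //.
    exact: shapelet_measurable.
  apply: integrableS (integrable_funrpos mD intNw) => //.
  by apply: measurableI => //; exact: shapelet_measurable.
have intpq i : mu.-integrable D (EFin \o shapelet_integrand w alpha i).
  have := integrableB mD
    (integrableZr mD (Num.max ((bearing_matrix J *m alpha) i 0) 0) (intp i))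
    (integrableZr mD (Num.min ((bearing_matrix J *m alpha) i 0) 1) (intq i)).
  by [].
transitivity (\int[mu]_(x in D) \sum_(i < nO) shapelet_integrand w alpha i x).
  congr fine; apply: ae_eq_integral => //.
  - apply/measurable_EFinP; apply: measurable_maxr.
      apply: measurable_funM => //; apply: measurable_sum => j.
      apply: measurable_funM => //; apply: measurable_indic.
      exact: (theta_measurable true hD (hS j)).
    exact: measurable_minr.
  - apply/measurable_EFinP; apply: measurable_sum => i.
    by apply/measurable_EFinP; exact: measurable_int (intpq i).
  - have ae_filter := ae_filter_ringOfSetsType (@lebesgue_rV R d).
    apply: filterS (ae_off_boundary hD hS) => x nbx Dx.
    by congr EFin; rewrite -integrand_shapelets.
rewrite Rintegral_sum//; apply: eq_bigr => i _; rewrite /shapelet_cost.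
rewrite RintegralB//;
  [|exact: integrableZr (intp i)|exact: integrableZr (intq i)].
rewrite !RintegralZr// -!Rintegral_mkcondr (setIidr (@shapelet_sub i)).
congr (_ - _ * _); apply: eq_Rintegral => x _.
by rewrite /w opprB.
Qed.

End cost.

(** * First-order optimality for separable costs *)

Section first_order_condition.
Context {R : realType} {m n : nat}.
Variables (B : 'M[R]_(m, n)) (c a : 'cV[R]_n).
Variables (f : 'I_m -> R -> R) (sigma : 'I_m -> R) (etac : R).

Hypothesis subgradient : forall i x,
  f i ((B *m a) i 0) + sigma i * (x - (B *m a) i 0) <= f i x.
Hypothesis stationary : forall j, \sum_i sigma i * B i j = etac * c j 0.

(** Stationarity makes the linear part of the minorant a multiple of
c^T (a' - a). *)
Lemma sum_subgradient (a' : 'cV[R]_n) : (c^T *m a') 0 0 = (c^T *m a) 0 0 ->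
  \sum_i sigma i * ((B *m a') i 0 - (B *m a) i 0) = 0.
Proof.
move=> ca'.
transitivity (\sum_i \sum_j sigma i * B i j * (a' j 0 - a j 0)).
  apply: eq_bigr => i _; rewrite !mxE -sumrB mulr_sumr.
  by apply: eq_bigr => j _; rewrite -mulrBr mulrA.
rewrite exchange_big/=.
under eq_bigr do rewrite -mulr_suml stationary -mulrA mulrBr.
rewrite -mulr_sumr sumrB.
move: ca'; rewrite !mxE.
under eq_bigr do rewrite mxE.
under [X in _ = X -> _]eq_bigr do rewrite mxE.
by move=> ->; rewrite subrr mulr0.
Qed.

Lemma first_order_minimizer (a' : 'cV[R]_n) :
  (c^T *m a') 0 0 = (c^T *m a) 0 0 ->
  \sum_i f i ((B *m a) i 0) <= \sum_i f i ((B *m a') i 0).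
Proof.
move=> /sum_subgradient sum0.
rewrite -[leLHS]addr0 -[X in _ + X <= _]sum0 -big_split/=.
by apply: ler_sum => i _; exact: subgradient.
Qed.

(** If a' is no worse than a, then the minorant is attained at a' in every
coordinate, and by strictness a' - a is orthogonal to the rows of B in A; it
is also orthogonal to c, and these vectors span the whole space. *)
Lemma first_order_unique (A : {set 'I_m}) (a' : 'cV[R]_n) :
  (forall i x, i \in A -> x != (B *m a) i 0 ->
    f i ((B *m a) i 0) + sigma i * (x - (B *m a) i 0) < f i x) ->
  row_free (row_mx (row_restrict A B)^T c) ->
  (c^T *m a') 0 0 = (c^T *m a) 0 0 ->
  \sum_i f i ((B *m a') i 0) <= \sum_i f i ((B *m a) i 0) -> a' = a.
Proof.
move=> strict freeM ca' le_a'.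
have tight i : f i ((B *m a) i 0) + sigma i * ((B *m a') i 0 - (B *m a) i 0)
               = f i ((B *m a') i 0).
  have : \sum_i (f i ((B *m a') i 0) - (f i ((B *m a) i 0) +
           sigma i * ((B *m a') i 0 - (B *m a) i 0))) == 0.
    rewrite eq_le; apply/andP; split.
      by rewrite sumrB big_split/= (sum_subgradient ca') addr0 subr_le0.
    by apply: sumr_ge0 => k _; rewrite subr_ge0.
  rewrite psumr_eq0; last by move=> k _; rewrite subr_ge0.
  by move=> /allP/(_ i)/=; rewrite mem_index_enum => /(_ isT)/eqP/subr0_eq.
have BA i : i \in A -> (B *m a') i 0 = (B *m a) i 0.
  move=> iA; apply/eqP; apply: contraT => /(strict i _ iA).
  by rewrite tight ltxx.
apply/eqP; rewrite -subr_eq0 -trmx_eq0; apply/eqP.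
apply: (row_free_inj freeM); rewrite mul0mx mul_mx_row -[RHS]row_mx0.
congr row_mx.
  rewrite -trmx_mul; apply/matrixP => i k; rewrite !mxE.
  have := BA _ (enum_valP k); rewrite !mxE => /eqP; rewrite -subr_eq0 => /eqP.
  rewrite -sumrB => h; rewrite -[RHS]h; apply: eq_bigr => j _.
  by rewrite !mxE ord1 mulrBr.
apply/matrixP => i k; rewrite !ord1.
move: ca'; rewrite !mxE => /eqP; rewrite -subr_eq0 -sumrB => /eqP h.
by rewrite -[RHS]h; apply: eq_bigr => j _; rewrite !mxE; ring.
Qed.

End first_order_condition.

(** * The optimality certificate *)

Theorem theorem4p7 (R : realType) (d : nat) (D : set 'rV[R]_d)
    (Pin Pex : 'rV[R]_d -> R) (ns nO : nat) (S : 'I_ns -> set 'rV[R]_d)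
    (J : 'I_nO -> {ffun 'I_ns -> bool}) (alphas c : 'cV[R]_ns)
    (hD : imaging_domain D) (hPin : nonneg_integrable D Pin) (hPex : nonneg_integrable D Pex)
    (hS : forall j, shape_in D (S j)) (hJ : shapelet_indexing D S J) :
  let B : 'M[R]_(nO, ns) := bearing_matrix J in
  let p i := p_mass Pin Pex (omega D S (J i)) in
  let q i := q_mass Pin Pex (omega D S (J i)) in
  let I_ j := [set i | J i j]%SET in
  let Gamma := [set j | alphas j 0 != 0]%SET in
  let tau := \sum_(j < ns) `|alphas j 0| in
  let betas := B *m alphas in
  let Gamma0n := [set i | betas i 0 < 0]%SET in
  let Gamma0 := [set i | betas i 0 == 0]%SET in
  let Gamma1 := [set i | betas i 0 == 1]%SET in
  let Gamma1p := [set i | 1 < betas i 0]%SET in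
  let A := (Gamma0 :|: Gamma1)%SET in
  let l : 'cV[R]_#|A| := \col_k (let i := enum_val k in
    if i \in Gamma0 then q i - p i else - p i) in
  let u : 'cV[R]_#|A| := \col_k (let i := enum_val k in
    if i \in Gamma0 then q i else q i - p i) in
  let e : 'cV[R]_ns := \col_j (\sum_(i in (I_ j :&: Gamma1p)%SET) p i
    - \sum_(i in (I_ j :&: Gamma0n)%SET) q i) in
  let M : 'M[R]_(ns, #|A| + 1) := row_mx (row_restrict A B)^T c in
  (forall j, j \in Gamma -> c j 0 = Num.sg (alphas j 0)) ->
  \big[Num.max/0]_(j | j \notin Gamma) `|c j 0| <= 1 ->
  (forall i, ~~ (0 < betas i 0 < 1)) ->
  row_free M ->
  (exists (eta : 'cV[R]_#|A|) (eta_c : R),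
    M *m col_mx eta eta_c%:M = e /\
    forall k, l k 0 < eta k 0 < u k 0) ->
  unique (minimizer (shape_cost D Pin Pex S) (feasible c tau)) alphas.
Proof.
move=> B p q I_ Gamma tau betas Gamma0n Gamma0 Gamma1 Gamma1p A l u e M.
move=> csg _ beta01 freeM [eta [etac [Meta eta_lu]]].
have p0 i : 0 <= p i by apply: Rintegral_ge0 => x _; rewrite le_max lexx orbT.
have q0 i : 0 <= q i by apply: Rintegral_ge0 => x _; rewrite le_max lexx orbT.
pose f i := shapelet_cost (p i) (q i).
have costE alpha :
    shape_cost D Pin Pex S alpha = \sum_i f i ((B *m alpha) i 0).
  exact: shape_costE.
have feas : feasible c tau alphas.
  rewrite /feasible mxE; apply: eq_bigr => j _; rewrite mxE.
  have [->|aj] := eqVneq (alphas j 0) 0; first by rewrite mulr0 normr0.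
  by rewrite csg ?inE// [RHS]normrEsg.
(* Indexing eta by shapelets instead of positions in A makes sums over A
   comparable with sums over all shapelets. *)
pose etaA i := \sum_(k | enum_val k == i :> 'I_nO) eta k 0.
have etaAE k : etaA (enum_val k) = eta k 0.
  rewrite /etaA (big_pred1 k)// => k'; apply/eqP/eqP => [/enum_val_inj//|->//].
(* A subgradient of the separable cost at betas: eta bounds minus the slope
   at the kinks. *)
pose sigma i := if betas i 0 < 0 then - q i
                else if 1 < betas i 0 then p i else - etaA i.
have inA i : (i \in A) = ~~ (betas i 0 < 0) && ~~ (1 < betas i 0).
  rewrite !inE; have := beta01 i.
  have [b0|b0|->] := ltgtP (betas i 0) 0; last by rewrite ltr10.
    by rewrite (lt_eqF (lt_trans b0 ltr01)).
  by have [] := ltgtP (betas i 0) 1.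
have strict i x : i \in A -> x != betas i 0 ->
    f i (betas i 0) + sigma i * (x - betas i 0) < f i x.
  move=> iA; have := iA; rewrite {1}inA => /andP[/negPf b0 /negPf b1].
  rewrite /sigma b0 b1.
  have [k ik] : exists k : 'I_#|A|, i = enum_val k.
    by exists (enum_rank_in iA i); rewrite enum_rankK_in.
  have : (if i \in Gamma0 then q i - p i else - p i) < etaA i <
         (if i \in Gamma0 then q i else q i - p i).
    by have := eta_lu k; rewrite [l _ _]mxE [u _ _]mxE ik etaAE.
  move: iA; rewrite !inE.
  have [->|_ /= /eqP ->] := eqVneq (betas i 0) 0 => [_|] /andP[l_eta eta_u].
    by apply: shapelet_cost_at0 => //; apply/andP; split; lra.
  by apply: shapelet_cost_at1 => //; apply/andP; split; lra.
have subgradient i x : f i (betas i 0) + sigma i * (x - betas i 0) <= f i x.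
  have [iA|] := boolP (i \in A).
    have [->|xb] := eqVneq x (betas i 0); first by rewrite subrr mulr0 addr0.
    exact/ltW/strict.
  rewrite inA negb_and !negbK /sigma.
  case: ifPn => [b0 _|_ /= b1]; first exact: shapelet_cost_lt0.
  by rewrite b1; exact: shapelet_cost_gt1.
have stationary j : \sum_i sigma i * B i j = etac * c j 0.
  have := congr1 (fun v : 'cV_ns => v j 0) Meta.
  rewrite mul_row_col !mxE big_ord1 !mxE eqxx mulr1n.
  have -> : \sum_k (row_restrict A B)^T j k * eta k 0 =
            \sum_(i in A) B i j * etaA i.
    by rewrite [RHS]big_enum_val; apply: eq_bigr => k _; rewrite !mxE etaAE.
  move=> Mj; transitivity (\sum_(i in (I_ j :&: Gamma1p)%SET) p i -
    \sum_(i in (I_ j :&: Gamma0n)%SET) q i - \sum_(i in A) B i j * etaA i);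
    last by rewrite mulrC; move: Mj; lra.
  rewrite [X in _ = X - _ - _]big_mkcond [X in _ - X - _]big_mkcond.
  rewrite [X in _ - _ - X]big_mkcond/=.
  rewrite -!sumrB; apply: eq_bigr => i _.
  rewrite inA !inE mxE /sigma.
  have [b0|b0] := ltP (betas i 0) 0; have [b1|b1] := ltP 1 (betas i 0);
    case: (J i j) => //=; lra.
split; first split => // alpha' feas'.
  rewrite !costE; apply: (first_order_minimizer subgradient stationary).
  by rewrite [LHS]feas' [RHS]feas.
move=> alpha' [feas' /(_ _ feas) min'].
apply/esym/(first_order_unique subgradient stationary strict freeM).
  by rewrite [LHS]feas' [RHS]feas.
by rewrite -!costE.
Qed.
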